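(* Let $1\le s<q<r\le\infty$ and let $\{T_t\}_{t\ge0}$ be a semigroup acting on a subset $D$ of $L^q(\Sigma,\mu)$ such that, for some $\omega\ge0$ and some $u_0\in L^s\cap L^r(\Sigma,\mu)$, $$\|T_tu-u_0\|_s\le e^{\omega t}\|u-u_0\|_s\qquad\text{for every }u\in D\cap L^s(\Sigma,\mu),\ t>0.$$ Suppose there exist $C>0$ and exponents $\alpha>0$, $\beta>0$, $\gamma>0$ such that $$\|T_tu-u_0\|_r\le C\,t^{-\alpha}e^{\omega\beta t}\|u-u_0\|_q^\gamma\qquad\text{for every }t>0,\ u\in D.$$ Set $\theta_s=\frac{(r-q)s}{q(r-s)}$ if $r<\infty$ and $\theta_s=\frac sq$ if $r=\infty$, and assume that $\gamma(1-\theta_s)<1$. Then $$\|T_tu-u_0\|_r\le\Big(C\,2^{\frac{\alpha}{1-\gamma(1-\theta_s)}}\Big)^{\frac1{1-\gamma(1-\theta_s)}}t^{-\alpha_s}e^{\omega\beta_st}\|u-u_0\|_s^{\gamma_s}$$ for every $t>0$ and $u\in D\cap L^s(\Sigma,\mu)$, with exponents $$\alpha_s=\frac{\alpha}{1-\gamma(1-\theta_s)},\qquad\beta_s=\frac{(\beta/2)+\gamma\theta_s}{1-\gamma(1-\theta_s)},\qquad\gamma_s=\frac{\gamma\,\theta_s}{1-\gamma(1-\theta_s)}.$$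
   Context: $(\Sigma,\mu)$ is a $\sigma$-finite measure space and $\|\cdot\|_q$ is the norm of $L^q(\Sigma,\mu)$. A semigroup acting on $D$ is a family of (in general nonlinear) maps $T_t:D\to D$, $t\ge0$, with $T_{t+s}=T_t\circ T_s$ for all $t,s\ge0$. *)

(* Defs.v *)
From HB Require Import structures.
From mathcomp Require Import all_boot all_order all_algebra.
From mathcomp Require Import all_classical all_reals all_analysis.

Set Implicit Arguments.
Unset Strict Implicit.
Unset Printing Implicit Defensive.

Import Order.TTheory GRing.Theory Num.Theory.
Import numFieldNormedType.Exports.

Local Open Scope classical_set_scope.
Local Open Scope ring_scope.

(* The values of [T] outside [D], or at negative times, are junk.  [T 0] is not
   required to be the identity. *)
Definition semigroup_on (R : realType) (X : Type) (D : set X)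
    (T : R -> X -> X) : Prop :=
  (forall t u, 0 <= t -> D u -> D (T t u)) /\
  (forall t s u, 0 <= t -> 0 <= s -> D u -> T (t + s) u = T t (T s u)).

(* The last branch is only meant for [r = +oo]: [-oo] is excluded by [q < r]. *)
Definition theta_exp (R : realType) (s q : R) (r : \bar R) : R :=
  match r with
  | r'%:E => (r' - q) * s / (q * (r' - s))
  | _ => s / q
  end.

(* Main.v *)
Require Import Defs.
From HB Require Import structures.
From mathcomp Require Import all_boot all_order all_algebra.
From mathcomp Require Import all_classical all_reals all_analysis.
From mathcomp Require Import ess_sup_inf measurable_realfun ring lra.

Set Implicit Arguments.
Unset Strict Implicit.
Unset Printing Implicit Defensive.

Import Order.TTheory GRing.Theory Num.Theory.
Import numFieldNormedType.Exports.

Local Open Scope classical_set_scope.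
Local Open Scope ring_scope.

(* Put v(tau) = T_tau u - u0 and a = gamma (1 - theta_s).  Writing
   T_tau = T_(tau/2) o T_(tau/2), the L^q-L^r smoothing estimate on
   [tau/2, tau], the interpolation inequality
   ||v||_q <= ||v||_s^theta_s ||v||_r^(1 - theta_s) at time tau/2, and the
   L^s growth bound on [0, tau/2] give
     ||v(tau)||_r <= K tau^-alpha ||v(tau/2)||_r^a,  0 < tau <= t,
   where K contains ||u - u0||_s^(gamma theta_s).  Since a < 1 this recursion
   is self-improving: it turns the a priori rate tau^-alpha, whose constant
   involves ||u - u0||_q, into the rate tau^-(alpha/(1-a)) with a constant
   depending on K, alpha and a only. *)

(** * Interpolation between Lebesgue norms *)

Lemma theta_exp_bounds (R : realType) (s q : R) (r : \bar R) :
  0 < s -> s < q -> (q%:E < r)%E -> 0 < theta_exp s q r < 1.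
Proof.
move=> s0 sq; have q0 := lt_trans s0 sq.
case: r => [r| |]//=; rewrite ?lte_fin => qr; last first.
  by rewrite divr_gt0//= ltr_pdivrMr// mul1r.
have rs : 0 < r - s by rewrite subr_gt0 (lt_trans sq).
have qrs : 0 < q * (r - s) by rewrite mulr_gt0.
apply/andP; split; first by rewrite divr_gt0// mulr_gt0 ?subr_gt0.
(* The right side minus the left side is [r * (q - s)]. *)
by rewrite ltr_pdivrMr// mul1r; nra.
Qed.

Section interpolation.
Context d (X : measurableType d) (R : realType).
Variable mu : {measure set X -> \bar R}.
Implicit Type f : X -> R.
Local Open Scope ereal_scope.
Local Notation "'N_ p [ f ]" := (Lnorm mu p (EFin \o f)).

Lemma poweRrK (p : R) (x : \bar R) : (0 < p)%R -> 0 <= x ->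
  (x `^ p) `^ p^-1 = x.
Proof. by move=> p0 x0; rewrite -poweRrM divff ?gt_eqF// poweRe1. Qed.

Lemma ae_le_Lnormy f : {ae mu, forall x, `|f x|%:E <= 'N_+oo[f]}.
Proof.
rewrite unlock /Lnorm; case: ifPn => [_|mu0].
  exact: (ess_sup_ge mu (abse \o (EFin \o f))).
(* On a space of measure zero the norm is 0 by convention, and the whole space serves as the
   exceptional null set. *)
exists setT; split => //.
by apply/eqP; rewrite eq_le measure_ge0 andbT leNgt.
Qed.

Lemma measurable_norm_powR f p : measurable_fun setT f ->
  measurable_fun setT (fun x => `|f x| `^ p)%R.
Proof.
move=> mf; apply: (@measurableT_comp _ _ _ _ _ _ (@powR R ^~ p)) => //.
exact: measurableT_comp.
Qed.

Lemma Lnorm_norm_powR f (p c : R) : (0 < p)%R -> (0 < c)%R ->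
  'N_(p / c)%:E[(fun x => `|f x| `^ c)%R] = 'N_p%:E[f] `^ c.
Proof.
move=> p0 c0; rewrite unlock /Lnorm -poweRrM invf_div [(p^-1 * c)%R]mulrC.
congr (_ `^ _).
apply: eq_integral => x _ /=; congr EFin.
by rewrite norm_powR// normr_id -powRrM mulrC divfK// gt_eqF.
Qed.

(** Hölder's inequality for the splitting [|f|^q = |f|^(q th) * |f|^(q (1 - th))] with exponents
    [s / (q th)] and [r / (q (1 - th))]. They are conjugate because
    [th / s + (1 - th) / r = 1 / q]. *)
Lemma Lnorm_interpolation_fin f (s q r : R) : measurable_fun setT f ->
  (0 < s)%R -> (s < q)%R -> (q < r)%R ->
  'N_q%:E[f] <= 'N_s%:E[f] `^ theta_exp s q r%:E
                * 'N_r%:E[f] `^ (1 - theta_exp s q r%:E).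
Proof.
move=> mf s0 sq qr; have q0 := lt_trans s0 sq; have r0 := lt_trans q0 qr.
have /andP[] : (0 < theta_exp s q r%:E < 1)%R by exact: theta_exp_bounds.
have : (theta_exp s q r%:E / s + (1 - theta_exp s q r%:E) / r = q^-1)%R.
  rewrite /=; field; rewrite !gt_eqF// ?subr_gt0//; exact: lt_trans qr.
move: (theta_exp s q r%:E) => th thE th0; rewrite -subr_gt0 => th1.
have qth0 := mulr_gt0 q0 th0; have qth1 := mulr_gt0 q0 th1.
have := @hoelder _ _ _ mu (fun x => `|f x| `^ (q * th))%R
  (fun x => `|f x| `^ (q * (1 - th)))%R _ _
  (measurable_norm_powR _ mf) (measurable_norm_powR _ mf)
  (divr_gt0 s0 qth0) (divr_gt0 r0 qth1).
rewrite !Lnorm_norm_powR// !invf_div -!mulrA -mulrDr thE divff ?gt_eqF//.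
move=> /(_ erefl).
have -> : 'N_1[((fun x => `|f x| `^ (q * th))
    \* (fun x => `|f x| `^ (q * (1 - th))))%R] = 'N_q%:E[f] `^ q.
  rewrite poweR_Lnorm ?gt_eqF// Lnorm1; apply: eq_integral => x _ /=.
  rewrite -powRD -mulrDr subrKC mulr1; last by rewrite gt_eqF.
  by rewrite ger0_norm// powR_ge0.
move=> holder.
rewrite -[leLHS](@poweRrK q) ?Lnorm_ge0//.
rewrite -[leRHS](@poweRrK q) ?mule_ge0 ?poweR_ge0//.
rewrite gt0_ler_poweR ?in_itv/= ?leey ?andbT ?poweR_ge0 ?invr_ge0 ?(ltW q0)//.
by rewrite poweRM ?poweR_ge0// -!poweRrM ![(_ * q)%R]mulrC.
Qed.

(** With [M] the essential supremum of [|f|], one has [|f|^q <= M^(q - s) * |f|^s] almost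
    everywhere; integrate and take [q]-th roots. *)
Lemma Lnorm_interpolationy f (s q : R) : measurable_fun setT f ->
  (0 < s)%R -> (s < q)%R -> 'N_+oo[f] < +oo ->
  'N_q%:E[f] <= 'N_s%:E[f] `^ (s / q) * 'N_+oo[f] `^ (1 - s / q).
Proof.
move=> mf s0 sq Nfin; have q0 := lt_trans s0 sq.
have MfE : (fine 'N_+oo[f])%:E = 'N_+oo[f].
  by rewrite fineK// ge0_fin_numE// Lnorm_ge0.
have M0 : (0 <= fine 'N_+oo[f])%R by rewrite fine_ge0// Lnorm_ge0.
have := ae_le_Lnormy f; rewrite -MfE.
set M := fine _ in M0 *; move=> fM.
have H : \int[mu]_x (`|f x| `^ q)%:E
    <= M%:E `^ (q - s) * \int[mu]_x (`|f x| `^ s)%:E.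
  rewrite poweR_EFin -ge0_integralZl_EFin ?powR_ge0//; last first.
    exact/measurable_EFinP/measurable_norm_powR.
  apply: ae_ge0_le_integral => //.
  - exact/measurable_EFinP/measurable_norm_powR.
  - by move=> x _; rewrite -EFinM lee_fin mulr_ge0// powR_ge0.
  - apply/measurable_EFinP/measurable_funM => //.
    exact/measurable_norm_powR.
  apply: filterS fM => x; rewrite lee_fin => fxM _.
  rewrite -EFinM lee_fin -{1}(subrK s q) [leLHS]powRD; last first.
    by rewrite subrK gt_eqF.
  by rewrite ler_wpM2r ?powR_ge0// ge0_ler_powR ?nnegrE ?subr_ge0 ?(ltW sq)//.
have qsE : (1 - s / q = (q - s) / q)%R by field; rewrite gt_eqF.
rewrite muleC qsE 2!poweRrM poweR_Lnorm ?gt_eqF//.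
rewrite -poweRM ?poweR_ge0//; last first.
  by apply: integral_ge0 => x _; rewrite poweR_ge0.
rewrite -[leLHS](@poweRrK q) ?Lnorm_ge0// poweR_Lnorm ?gt_eqF//.
rewrite gt0_ler_poweR ?in_itv/= ?leey ?andbT ?invr_ge0//.
- exact: ltW.
- by apply: integral_ge0 => x _; rewrite lee_fin powR_ge0.
- rewrite mule_ge0 ?lee_fin ?powR_ge0//.
  by apply: integral_ge0 => x _; rewrite lee_fin powR_ge0.
Qed.

Lemma Lnorm_interpolation f (s q : R) (r : \bar R) : measurable_fun setT f ->
  (0 < s)%R -> (s < q)%R -> q%:E < r -> 'N_r[f] < +oo ->
  'N_q%:E[f] <= 'N_s%:E[f] `^ theta_exp s q r
                * 'N_r[f] `^ (1 - theta_exp s q r).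
Proof.
case: r => [r| |]// mf s0 sq; last by move=> _; exact: Lnorm_interpolationy.
by rewrite lte_fin => qr _; exact: Lnorm_interpolation_fin.
Qed.

End interpolation.

(** * Self-improvement of decay rates for real functions of time *)

(* The function [tau^(alpha/(1-a)) * phi tau] is bounded on ]0, t] by the a
   priori estimate, and the recursion bounds its supremum [h] by
   [K * 2^(a*alpha/(1-a)) * h^a]. *)
Lemma self_improving_bound (R : realType) (phi : R -> R) (K K0 alpha a t : R) :
  0 <= K -> 0 < alpha -> 0 < a -> a < 1 -> 0 < t ->
  (forall tau : R, 0 < tau -> 0 <= phi tau) ->
  (forall tau : R, 0 < tau -> tau <= t -> phi tau <= K0 * tau `^ (- alpha)) ->
  (forall tau : R, 0 < tau -> tau <= t ->
    phi tau <= K * tau `^ (- alpha) * phi (tau / 2) `^ a) ->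
  phi t <= (K * 2 `^ (a * (alpha / (1 - a)))) `^ (1 / (1 - a))
           * t `^ (- (alpha / (1 - a))).
Proof.
move=> K_ge0 alpha0 a0 a1 t0 phi0 apriori rec.
have a1' : 0 < 1 - a by rewrite subr_gt0.
set A := alpha / (1 - a).
have A0 : 0 < A by rewrite divr_gt0.
have AE : A - alpha = a * A by rewrite /A; field; rewrite gt_eqF.
pose S := [set tau `^ A * phi tau | tau in [set x | 0 < x <= t]].
have tauA (tau : R) : 0 < tau -> tau `^ A * tau `^ (- alpha) = tau `^ (a * A).
  by move=> tau0; rewrite -powRD ?AE// (gt_eqF tau0) implybT.
(* Since [A - alpha = a * A] is positive, the weight [tau^A] absorbs the a priori singularity
   [tau^(-alpha)] and leaves [tau^(a A) <= t^(a A)]. *)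
have ubS : has_ubound S.
  exists (t `^ (a * A) * `|K0|) => _ /= [tau + <-].
  move=> /andP[tau0 taut].
  apply: (@le_trans _ _ (tau `^ A * (K0 * tau `^ (- alpha)))).
    by rewrite ler_wpM2l ?powR_ge0// apriori.
  rewrite mulrCA tauA// mulrC.
  apply: (@le_trans _ _ (tau `^ (a * A) * `|K0|)).
    by rewrite ler_wpM2l ?powR_ge0// ler_norm.
  rewrite ler_wpM2r// ge0_ler_powR ?nnegrE ?(ltW tau0) ?(ltW t0)//.
  by rewrite mulr_ge0 ?ltW.
have leS (tau : R) : 0 < tau -> tau <= t -> tau `^ A * phi tau <= sup S.
  move=> tau0 taut; apply: ub_le_sup => //; exists tau => //=.
  by rewrite tau0.
have S0 : 0 <= sup S.
  by apply: le_trans (leS t t0 (lexx t)); rewrite mulr_ge0 ?powR_ge0 ?phi0.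
set B := K * 2 `^ (a * A).
have B0 : 0 <= B by rewrite mulr_ge0 ?powR_ge0.
have hB : sup S <= B * sup S `^ a.
  apply: ge_sup; first by exists (t `^ A * phi t), t => //=; rewrite t0/=.
  move=> _ /= [tau + <-]; move=> /andP[tau0 taut].
  have tau20 : 0 < tau / 2 by rewrite divr_gt0.
  have tau2t : tau / 2 <= t by lra.
  apply: (@le_trans _ _
    (tau `^ A * (K * tau `^ (- alpha) * phi (tau / 2) `^ a))).
    by rewrite ler_wpM2l ?powR_ge0// rec.
  (* The factor [2^(a A)] in [B] comes from [tau^(a A) = 2^(a A) * (tau / 2)^(a A)], which rebuilds
     the element of [S] at time [tau / 2]. *)
  have -> : tau `^ A * (K * tau `^ (- alpha) * phi (tau / 2) `^ a)
      = B * ((tau / 2) `^ A * phi (tau / 2)) `^ a.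
    rewrite powRM ?powR_ge0 ?phi0// -powRrM (mulrC A a) mulrA [RHS]mulrA.
    congr (_ * _); rewrite mulrCA tauA// -mulrA -powRM ?(ltW tau20)//.
    by rewrite (mulrC 2) divfK.
  rewrite ler_wpM2l// ge0_ler_powR ?nnegrE ?(ltW a0)// ?leS//.
  by rewrite mulr_ge0 ?powR_ge0 ?phi0.
have hle : sup S <= B `^ (1 / (1 - a)).
  have [->|h0] := eqVneq (sup S) 0; first exact: powR_ge0.
  have hp : 0 < sup S by rewrite lt_neqAle eq_sym h0.
  (* Dividing by [sup S ^ a] is legitimate because the supremum is finite and now positive. *)
  have hB1 : sup S `^ (1 - a) <= B.
    by rewrite powRB ?h0 ?implybT// powRr1// ler_pdivrMr// powR_gt0.
  rewrite -[leLHS]powRr1// -[in leLHS](divff (lt0r_neq0 a1')) powRrM mul1r.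
  by rewrite ge0_ler_powR ?nnegrE ?powR_ge0 ?invr_ge0 ?(ltW a1').
rewrite powRN -ler_pdivrMr ?invr_gt0 ?powR_gt0// invrK mulrC.
exact: le_trans (leS t t0 (lexx t)) hle.
Qed.

(** Bookkeeping of constants, with [phi] standing for the [L^r] distance to [u0] along the orbit and
    [N] for the initial [L^s] distance. [K0] enters only the a priori bound and is absent from the
    conclusion. *)
Lemma smoothing_extrapolation (R : realType) (phi : R -> R)
    (C K0 N omega alpha beta gamma th t : R) :
  let a := gamma * (1 - th) in
  0 < C -> 0 <= N -> 0 <= omega -> 0 < alpha -> 0 < beta -> 0 < gamma ->
  0 < th < 1 -> a < 1 -> 0 < t ->
  (forall tau : R, 0 < tau -> 0 <= phi tau) ->
  (forall tau : R, 0 < tau -> tau <= t -> phi tau <= K0 * tau `^ (- alpha)) ->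
  (forall tau : R, 0 < tau -> tau <= t ->
    phi tau <= C * (tau / 2) `^ (- alpha) * expR (omega * beta * (tau / 2)) *
      ((expR (omega * (tau / 2)) * N) `^ th * phi (tau / 2) `^ (1 - th))
        `^ gamma) ->
  phi t <= (C * 2 `^ (alpha / (1 - a))) `^ (1 / (1 - a)) *
    t `^ (- (alpha / (1 - a))) *
    expR (omega * ((beta / 2 + gamma * th) / (1 - a)) * t) *
    N `^ (gamma * th / (1 - a)).
Proof.
move=> a; have aE : a = gamma * (1 - th) by []; clearbody a.
move=> C0 N0 omega0 alpha0 beta0 gamma0 /andP[th0 th1] a1 t0 phi0 apriori rec.
have th1' : 0 < 1 - th by rewrite subr_gt0.
have a0 : 0 < a by rewrite aE mulr_gt0.
have a1' : 0 < 1 - a by rewrite subr_gt0.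
have gth0 : 0 < gamma * th by rewrite mulr_gt0.
(* The exponent accumulated by one recursion step at [tau = t]; as [omega >= 0], it dominates the
   one at every earlier [tau], so [K] is independent of [tau]. *)
pose E := omega * (beta + gamma * th) * (t / 2).
pose K := C * 2 `^ alpha * expR E * N `^ (gamma * th).
have K_ge0 : 0 <= K by rewrite !mulr_ge0 ?powR_ge0 ?expR_ge0 ?(ltW C0).
have recK (tau : R) : 0 < tau -> tau <= t ->
    phi tau <= K * tau `^ (- alpha) * phi (tau / 2) `^ a.
  move=> tau0 taut; apply: le_trans (rec _ tau0 taut) _.
  have tau20 : 0 < tau / 2 by rewrite divr_gt0.
  rewrite (powRM gamma (powR_ge0 _ _) (powR_ge0 _ _)) -!powRrM.
  rewrite (powRM _ (expR_ge0 _) N0) -!expRM.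
  rewrite (mulrC th) (mulrC (1 - th)) -aE mulrA ler_wpM2r ?powR_ge0//.
  have -> : (tau / 2) `^ (- alpha) = 2 `^ alpha * tau `^ (- alpha).
    rewrite powRM ?(ltW tau0) ?invr_ge0// mulrC; congr (_ * _).
    by rewrite -[2^-1]powR_inv1// -powRrM mulN1r opprK.
  have -> : C * (2 `^ alpha * tau `^ (- alpha))
      * expR (omega * beta * (tau / 2)) * (expR (omega * (tau / 2) * (gamma * th)) * N `^ (gamma * th))
    = C * 2 `^ alpha *
      (expR (omega * beta * (tau / 2))
        * expR (omega * (tau / 2) * (gamma * th)))
      * N `^ (gamma * th) * tau `^ (- alpha) by ring.
  rewrite -expRD /K !ler_wpM2r ?powR_ge0//.
  rewrite ler_wpM2l ?mulr_ge0 ?powR_ge0 ?(ltW C0)//.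
  rewrite ler_expR /E.
  have -> : omega * beta * (tau / 2) + omega * (tau / 2) * (gamma * th)
    = omega * (beta + gamma * th) * (tau / 2) by ring.
  by rewrite ler_wpM2l ?ler_wpM2r ?mulr_ge0 ?addr_ge0 ?(ltW beta0) ?(ltW gth0).
apply: le_trans
  (self_improving_bound K_ge0 alpha0 a0 a1 t0 phi0 apriori recK) _.
rewrite [leLHS]mulrC -[leRHS]mulrA -[leRHS]mulrA [leRHS]mulrCA.
rewrite ler_wpM2l ?powR_ge0//.
(* The halving factor [2^alpha] and the factor from the self-improvement merge, since [alpha + a *
   alpha / (1 - a) = alpha / (1 - a)]. *)
have -> : K * 2 `^ (a * (alpha / (1 - a)))
    = (C * 2 `^ (alpha / (1 - a))) * expR E * N `^ (gamma * th).
  have AE : alpha + a * (alpha / (1 - a)) = alpha / (1 - a).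
    by field; rewrite gt_eqF.
  by rewrite -[in RHS]AE powRD ?pnatr_eq0 ?implybT// /K; ring.
rewrite powRM ?mulr_ge0 ?powR_ge0 ?expR_ge0 ?(ltW C0)//.
rewrite powRM ?mulr_ge0 ?powR_ge0 ?expR_ge0 ?(ltW C0)//.
rewrite -powRrM -expRM !mul1r -mulrA ler_wpM2l ?powR_ge0//.
rewrite ler_wpM2r ?powR_ge0// ler_expR /E.
(* The argument yields [gamma * th / 2] in the growth exponent; it is enlarged to [gamma * th] to
   match the claim. *)
have -> : omega * (beta + gamma * th) * (t / 2) / (1 - a)
  = omega * ((beta / 2 + gamma * th / 2) / (1 - a)) * t.
  by field; rewrite gt_eqF.
rewrite ler_wpM2r ?(ltW t0)// ler_wpM2l// ler_wpM2r ?invr_ge0 ?(ltW a1')//.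
by rewrite lerD2l; lra.
Qed.

Lemma Lnorm_sub_lty d (X : measurableType d) (R : realType)
    (mu : {measure set X -> \bar R}) (p : \bar R) (f g : X -> R) :
  (1 <= p)%E -> f \in Lfun mu p -> g \in Lfun mu p ->
  ('N[mu]_p [EFin \o (f \- g)%R] < +oo)%E.
Proof.
move=> p1 fp /Lfun_oppr_closed gp.
have [_ /(_ f (- g) fp gp)] := Lfun_addr_closed mu p1.
by move=> /sub_Lfun_finLfun; rewrite inE.
Qed.

(** * Application to the semigroup *)

Theorem theorem4p3 (R : realType) (d : measure_display)
    (Sigma : measurableType d) (mu : {sigma_finite_measure set Sigma -> \bar R})
    (s q : R) (r : \bar R)
    (s1 : 1 <= s) (sq : s < q) (qr : (q%:E < r)%E)
    (q1 : (1 <= q%:E)%E)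
    (D : set (LspaceType mu q1))
    (T : R -> LspaceType mu q1 -> LspaceType mu q1)
    (semiT : semigroup_on D T)
    (omega : R) (omega0 : 0 <= omega)
    (u0 : {mfun_ mu, Sigma >-> measurableTypeR R})
    (u0s : (u0 : Sigma -> R) \in Lfun mu s%:E)
    (u0r : (u0 : Sigma -> R) \in Lfun mu r)
    (T_s : forall (u : LspaceType mu q1) (t : R),
       D u -> (u : Sigma -> R) \in Lfun mu s%:E -> 0 < t ->
       ('N[mu]_(s%:E) [EFin \o ((T t u : Sigma -> R) \- u0)%R]
        <= (expR (omega * t))%:E
           * 'N[mu]_(s%:E) [EFin \o ((u : Sigma -> R) \- u0)%R])%E)
    (C alpha beta gamma : R)
    (C0 : 0 < C) (alpha0 : 0 < alpha) (beta0 : 0 < beta) (gamma0 : 0 < gamma)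
    (T_qr : forall (t : R) (u : LspaceType mu q1),
       0 < t -> D u ->
       ('N[mu]_r [EFin \o ((T t u : Sigma -> R) \- u0)%R]
        <= (C * t `^ (- alpha) * expR (omega * beta * t))%:E
           * 'N[mu]_(q%:E) [EFin \o ((u : Sigma -> R) \- u0)%R] `^ gamma)%E)
    (gamma_theta : gamma * (1 - theta_exp s q r) < 1) :
  let theta_s := theta_exp s q r in
  let alpha_s := alpha / (1 - gamma * (1 - theta_s)) in
  let beta_s := (beta / 2 + gamma * theta_s) / (1 - gamma * (1 - theta_s)) in
  let gamma_s := gamma * theta_s / (1 - gamma * (1 - theta_s)) in
  forall (t : R) (u : LspaceType mu q1),
    0 < t -> D u -> (u : Sigma -> R) \in Lfun mu s%:E ->
    ('N[mu]_r [EFin \o ((T t u : Sigma -> R) \- u0)%R]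
     <= ((C * 2 `^ (alpha / (1 - gamma * (1 - theta_s))))
           `^ (1 / (1 - gamma * (1 - theta_s)))
         * t `^ (- alpha_s) * expR (omega * beta_s * t))%:E
        * 'N[mu]_(s%:E) [EFin \o ((u : Sigma -> R) \- u0)%R] `^ gamma_s)%E.
Proof.
move=> ths als bes gas t u t0 Du us.
have s0 : 0 < s by exact: lt_le_trans ltr01 s1.
have thb : 0 < ths < 1 by exact: theta_exp_bounds.
have mfunq (w : {mfun_ mu, Sigma >-> measurableTypeR R}) :
    measurable_fun setT (w : Sigma -> R).
  exact: (measurable_funPT (repr w)).
have mv (w : LspaceType mu q1) :
    measurable_fun setT ((w : Sigma -> R) \- u0)%R.
  by apply: measurable_funB; exact: mfunq.
have us_lty : ('N[mu]_(s%:E) [EFin \o ((u : Sigma -> R) \- u0)%R] < +oo)%E.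
  by apply: Lnorm_sub_lty.
have uq_lty : ('N[mu]_(q%:E) [EFin \o ((u : Sigma -> R) \- u0)%R] < +oo)%E.
  apply: Lnorm_sub_lty => //.
    apply/andP; split; rewrite inE; first exact: mfunq.
    exact: Lebesgue_finite.
  apply/andP; split; rewrite inE; first exact: mfunq.
  (* Interpolation between [L^s] and [L^r] places [u0] in [L^q]. *)
  move: u0s u0r => /sub_Lfun_finLfun/[!inE] u0s /sub_Lfun_finLfun/[!inE] u0r.
  apply: le_lt_trans (Lnorm_interpolation _ s0 sq qr u0r) _.
    exact: mfunq.
  by rewrite lte_mul_pinfty ?poweR_ge0 ?fin_num_poweR ?poweR_lty ?ge0_fin_numE
    ?Lnorm_ge0.
have Nr_lty (tau : R) : 0 < tau ->
    ('N[mu]_r [EFin \o ((T tau u : Sigma -> R) \- u0)%R] < +oo)%E.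
  move=> tau0; apply: le_lt_trans (T_qr _ _ tau0 Du) _.
  rewrite lte_mul_pinfty ?poweR_lty// lee_fin.
  by rewrite !mulr_ge0 ?powR_ge0 ?expR_ge0 ?(ltW C0).
(* The smoothing estimate makes this norm finite at positive times, so [fine] loses nothing
   there. *)
pose phi (tau : R) :=
  fine ('N[mu]_r [EFin \o ((T tau u : Sigma -> R) \- u0)%R]).
have phiE (tau : R) : 0 < tau ->
    ('N[mu]_r [EFin \o ((T tau u : Sigma -> R) \- u0)%R])%E = (phi tau)%:E.
  by move=> tau0; rewrite fineK// ge0_fin_numE ?Lnorm_ge0// Nr_lty.
pose N := fine ('N[mu]_(s%:E) [EFin \o ((u : Sigma -> R) \- u0)%R]).
have NE : ('N[mu]_(s%:E) [EFin \o ((u : Sigma -> R) \- u0)%R])%E = N%:E.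
  by rewrite fineK// ge0_fin_numE ?Lnorm_ge0.
pose M := fine ('N[mu]_(q%:E) [EFin \o ((u : Sigma -> R) \- u0)%R]).
have ME : ('N[mu]_(q%:E) [EFin \o ((u : Sigma -> R) \- u0)%R])%E = M%:E.
  by rewrite fineK// ge0_fin_numE ?Lnorm_ge0.
rewrite phiE// NE poweR_EFin -EFinM lee_fin.
apply: (@smoothing_extrapolation _ _ _
    (C * expR (omega * beta * t) * M `^ gamma))
  => //.
- by rewrite fine_ge0 ?Lnorm_ge0.
- by move=> tau _; rewrite fine_ge0 ?Lnorm_ge0.
(* A priori bound: the growth factor at [tau] is replaced by its value at [t]. *)
- move=> tau tau0 taut; have := T_qr _ _ tau0 Du.
  rewrite phiE// ME poweR_EFin -EFinM lee_fin => /le_trans; apply.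
  rewrite [leRHS]mulrAC ler_wpM2r ?powR_ge0//.
  rewrite [leLHS]mulrAC ler_wpM2r ?powR_ge0//.
  rewrite ler_wpM2l ?(ltW C0)// ler_expR ler_wpM2l//.
  by rewrite mulr_ge0 ?(ltW beta0).
(* Recursion: smoothing restarts from [T (tau / 2) u], which stays in [D]; its [L^q] distance to
   [u0] is then interpolated and its [L^s] distance controlled by [T_s]. *)
- move=> tau tau0 taut; have tau20 : 0 < tau / 2 by rewrite divr_gt0.
  have [TD TT] := semiT.
  have := T_qr _ _ tau20 (TD _ _ (ltW tau20) Du).
  rewrite -TT ?(ltW tau20)// -splitr phiE// => H.
  rewrite -lee_fin; apply: le_trans H _; rewrite [leRHS]EFinM.
  rewrite lee_wpmul2l//.
    by rewrite lee_fin !mulr_ge0 ?powR_ge0 ?expR_ge0 ?(ltW C0).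
  rewrite -poweR_EFin gt0_ler_poweR ?in_itv/= ?leey ?andbT ?Lnorm_ge0
    ?(ltW gamma0)//.
    by rewrite lee_fin mulr_ge0 ?powR_ge0.
  apply: le_trans (Lnorm_interpolation (mv _) s0 sq qr (Nr_lty _ tau20)) _.
  rewrite phiE// EFinM -!poweR_EFin lee_wpmul2r ?poweR_ge0//.
  move/andP: thb => [th0 _].
  rewrite gt0_ler_poweR ?in_itv/= ?leey ?andbT ?Lnorm_ge0 ?(ltW th0)//.
    by rewrite lee_fin mulr_ge0 ?expR_ge0 ?fine_ge0 ?Lnorm_ge0.
  by rewrite EFinM -NE; exact: T_s.
Qed.
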